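(* Let $F$ be a field of characteristic zero and let $E$ be the unital infinite dimensional Grassmann algebra over $F$. The $T_E$-ideal of generalized polynomial identities of $E$, with either the action of the finite dimensional Grassmann algebra $E_k$ (for any $k\geq 1$) by left and right multiplication, or the action of $E$ itself by left and right multiplication, does not have the Specht property; that is, neither $\mathrm{Id}^E(E^{(k)})$, for any $k\ge 1$, nor $\mathrm{Id}^E(E)$ is finitely generated as a $T_E$-ideal.
   Context: All algebras are associative over a field $F$ of characteristic zero. $E$ is the unital algebra generated by $1,e_1,e_2,\ldots$ subject to $e_ie_j=-e_je_i$ for all $i,j$; it has basis $\{e_{i_1}\cdots e_{i_n}\mid i_1<\cdots<i_n,\ n\geq0\}$. $E_k$ is the subalgebra generated by $1,e_1,\ldots,e_k$. For a unital $F$-algebra $W$, a $W$-algebra is an $F$-algebra $A$ that is a unital $W$-bimodule such that $(a_1a_2)w=a_1(a_2w)$, $w(a_1a_2)=(wa_1)a_2$, $(a_1w)a_2=a_1(wa_2)$. Here $W=E$. The free $W$-algebra $W\langle X\rangle$ on $X=\{x_1,x_2,\ldots\}$ has $F$-basis $\{w_{i_0}x_{j_1}w_{i_1}\cdots x_{j_n}w_{i_n}\mid n\geq 1\}$, where the $w_{i_r}$ run over a fixed basis of $W$ and $j_1,\dots,j_n\ge1$ (expressions are multilinear in the $W$-entries); the product is juxtaposition followed by multiplication in $W$, $W$ acts by multiplying the outer entries, and $x_i=1_Wx_i1_W$. A $T_W$-ideal is a two-sided ideal of $W\langle X\rangle$ stable under left and right multiplication by $W$ and under all endomorphisms of $W\langle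 X\rangle$ as a $W$-algebra. It is finitely generated if it is the smallest $T_W$-ideal containing some finite set. $\mathrm{Id}^W(A)$ is the $T_W$-ideal of all $f\in W\langle X\rangle$ vanishing under all evaluations of the variables in $A$. $E^{(k)}$ is the algebra $E$ regarded as an $E$-algebra where $E$ acts as $E_k$ by left and right multiplication: $wa=\theta_k(w)a$, $aw=a\theta_k(w)$, where $\theta_k:E\to E_k$ is the unital homomorphism with $\theta_k(e_i)=e_i$ for $i\leq k$ and $\theta_k(e_j)=0$ for $j\geq k+1$. $\mathrm{Id}^E(E)$ refers to $E$ acting on itself by left and right multiplication. *)

(* Defs.v *)
From HB Require Import structures.
From mathcomp Require Import all_boot all_algebra.
From mathcomp Require Import finmap.
From mathcomp.multinomials Require Import monalg.

Set Implicit Arguments.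
Unset Strict Implicit.
Unset Printing Implicit Defensive.

Import GRing.Theory.
Local Open Scope fset_scope.
Local Open Scope ring_scope.

(* {malg F[K]} is the F-vector space with basis K, the basis vector attached  *)
(* to k being << k >>. Linear and bilinear maps are given on bases.           *)

Section LinearExtension.
Variables (F : fieldType) (K : choiceType) (V : lmodType F).
Implicit Types (h : K -> V) (g : {malg F[K]}).

Definition lin_ext h g : V := \sum_(k <- msupp g) g@_k *: h k.

Lemma lin_extEw h g (d : {fset K}) :
  msupp g `<=` d -> lin_ext h g = \sum_(k <- d) g@_k *: h k.
Proof.
move=> le; rewrite /lin_ext; apply: big_fset_incl => // k _ kNg.
by rewrite mcoeff_outdom // scale0r.
Qed.

Lemma lin_ext_is_linear h : linear (lin_ext h).
Proof.
move=> c f g; pose d := msupp f `|` msupp g.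
have le1 : msupp f `<=` d by rewrite fsubsetUl.
have le2 : msupp g `<=` d by rewrite fsubsetUr.
have le3 : msupp (c *: f + g) `<=` d.
  apply: fsubset_trans (msuppD_le _ _) _.
  by rewrite fsubUset le2 (fsubset_trans (msuppZ_le _ _) le1).
rewrite (lin_extEw h le1) (lin_extEw h le2) (lin_extEw h le3) scaler_sumr.
rewrite -big_split /=; apply: eq_bigr => k _.
by rewrite mcoeffD mcoeffZ scalerDl scalerA.
Qed.

HB.instance Definition _ h :=
  GRing.isLinear.Build F {malg F[K]} V *:%R (lin_ext h) (lin_ext_is_linear h).

Lemma lin_extU h k : lin_ext h << k >> = h k.
Proof. by rewrite (lin_extEw h msuppU_le) big_seq_fset1 mcoeffUU scale1r. Qed.

Lemma lin_ext_fun_linear c h1 h2 g :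
  lin_ext (fun k => c *: h1 k + h2 k) g = c *: lin_ext h1 g + lin_ext h2 g.
Proof.
rewrite /lin_ext scaler_sumr -big_split /=; apply: eq_bigr => k _.
by rewrite scalerDr !scalerA mulrC.
Qed.

Lemma eq_lin_ext h1 h2 : h1 =1 h2 -> lin_ext h1 =1 lin_ext h2.
Proof. by move=> eqh g; apply: eq_bigr => k _; rewrite eqh. Qed.

Lemma lin_ext_id (g : {malg F[K]}) :
  \sum_(k <- msupp g) g@_k *: << k >> = g.
Proof.
rewrite [RHS]monalgE; apply: eq_bigr => k _; apply/malgP=> k'.
by rewrite mcoeffZ !mcoeffU mulrnAr mulr1.
Qed.

Lemma malg_ind (P : {malg F[K]} -> Prop) :
    P 0 -> (forall c k g, P g -> P (c *: << k >> + g)) -> forall g, P g.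
Proof.
move=> P0 PD g; rewrite -[g]lin_ext_id; elim: (enum_fset _) => [|k s IHs].
  by rewrite big_nil.
by rewrite big_cons; apply: PD.
Qed.

Lemma malg_lin_eq (f1 f2 : {malg F[K]} -> V) :
  linear f1 -> linear f2 -> (forall k, f1 << k >> = f2 << k >>) -> f1 =1 f2.
Proof.
move=> lin1 lin2 eqf g.
pose l1 : {linear _ -> _} :=
  HB.pack f1 (GRing.isLinear.Build F {malg F[K]} V *:%R f1 lin1).
pose l2 : {linear _ -> _} :=
  HB.pack f2 (GRing.isLinear.Build F {malg F[K]} V *:%R f2 lin2).
change (l1 g = l2 g); elim/malg_ind: g => [|c k g IHg]; first by rewrite !linear0.
by rewrite !linearP IHg; congr (_ *: _ + _); apply: eqf.
Qed.

End LinearExtension.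

Lemma lin_ext_comp (F : fieldType) (K : choiceType) (V V' : lmodType F)
    (f : {linear V -> V'}) (h : K -> V) (g : {malg F[K]}) :
  f (lin_ext h g) = lin_ext (fun k => f (h k)) g.
Proof. by rewrite linear_sum; apply: eq_bigr => k _; rewrite linearZ. Qed.

Lemma lin_extK (F : fieldType) (K : choiceType) (V : lmodType F)
    (f : {linear {malg F[K]} -> V}) (g : {malg F[K]}) :
  lin_ext (fun k => f << k >>) g = f g.
Proof. by rewrite -lin_ext_comp /lin_ext lin_ext_id. Qed.

Lemma exchange_lin_ext (F : fieldType) (K L : choiceType) (V : lmodType F)
    (m : K -> L -> V) (f : {malg F[K]}) (g : {malg F[L]}) :
  lin_ext (fun k => lin_ext (m k) g) f =
  lin_ext (fun l => lin_ext (m^~ l) f) g.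
Proof.
rewrite /lin_ext; under eq_bigr do rewrite scaler_sumr.
rewrite exchange_big /=; apply: eq_bigr => l _; rewrite scaler_sumr.
by apply: eq_bigr => k _; rewrite !scalerA mulrC.
Qed.

Section BilinearExtension.
Variables (F : fieldType) (K L : choiceType) (V : lmodType F).
Variable m : K -> L -> V.

Definition bilin_ext (f : {malg F[K]}) (g : {malg F[L]}) : V :=
  lin_ext (fun k => lin_ext (m k) g) f.

Lemma bilin_extU k l : bilin_ext << k >> << l >> = m k l.
Proof. by rewrite /bilin_ext !lin_extU. Qed.

Lemma bilin_extPl g : linear (bilin_ext^~ g).
Proof. by move=> c f1 f2; rewrite /bilin_ext linearP. Qed.

Lemma bilin_extPr f : linear (bilin_ext f).
Proof.
move=> c g1 g2; rewrite /bilin_ext -lin_ext_fun_linear.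
by apply: eq_lin_ext => k; rewrite linearP.
Qed.

End BilinearExtension.

(* The basis vector of A = {i_1 < ... < i_n} is e_{i_1} ... e_{i_n}; indices  *)
(* start at 0. The product e_A e_B vanishes when A and B meet, and is         *)
(* (-1)^s e_(A u B) otherwise, s counting the pairs (a, b) with b < a.        *)

Definition grassmann (F : fieldType) : Type := {malg F[{fset nat}]}.

Section Grassmann.
Variable F : fieldType.
Local Notation E := (grassmann F).
Implicit Types (A B C : {fset nat}) (x y z : E).

HB.instance Definition _ := GRing.Lmodule.on E.

Definition gmon A : E := << A >>.

Definition inversions A B : nat := \sum_(a <- A) \sum_(b <- B) (b < a)%N.

Definition gmon_mul A B : E :=
  if [disjoint A & B]%fset then (-1) ^+ inversions A B *: gmon (A `|` B) else 0.

Definition gmul : E -> E -> E := bilin_ext gmon_mul.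


Definition gone : E := gmon fset0.

Lemma gmulUU A B : gmul (gmon A) (gmon B) = gmon_mul A B.
Proof. exact: bilin_extU. Qed.

Lemma gmulPl y : linear (gmul^~ y). Proof. exact: bilin_extPl. Qed.
Lemma gmulPr x : linear (gmul x). Proof. exact: bilin_extPr. Qed.

Lemma gmulZl c x y : gmul (c *: x) y = c *: gmul x y.
Proof. by rewrite /gmul /bilin_ext linearZ. Qed.

Lemma gmul0l y : gmul 0 y = 0.
Proof. by rewrite /gmul /bilin_ext linear0. Qed.

Lemma gmulZr c x y : gmul x (c *: y) = c *: gmul x y.
Proof.
by have := gmulPr x (c - 1) y y; rewrite !scalerBl !scale1r !subrK.
Qed.

Lemma gmul0r x : gmul x 0 = 0.
Proof. by have := gmulZr 0 x 0; rewrite !scale0r. Qed.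

Lemma inversions0l B : inversions fset0 B = 0%N.
Proof. by rewrite /inversions big_seq_fset0. Qed.

Lemma inversions0r A : inversions A fset0 = 0%N.
Proof. by rewrite /inversions big1 // => a _; rewrite big_seq_fset0. Qed.

Lemma big_fsetU_disj (T : choiceType) (A B : {fset T}) (f : T -> nat) :
  [disjoint A & B]%fset ->
  \sum_(a <- A `|` B) f a = (\sum_(a <- A) f a + \sum_(a <- B) f a)%N.
Proof.
move=> dAB; rewrite -big_cat /=; apply: perm_big; apply: uniq_perm.
- exact: fset_uniq.
- rewrite cat_uniq !fset_uniq andbT /=; apply/hasPn => b bB.
  by apply/negP => bA; move/fdisjointP: dAB => /(_ b bA); rewrite bB.
- by move=> a; rewrite mem_cat in_fsetU.
Qed.

Lemma inversionsUl A B C : [disjoint A & B]%fset ->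
  inversions (A `|` B) C = (inversions A C + inversions B C)%N.
Proof. exact: big_fsetU_disj. Qed.

Lemma inversionsUr A B C : [disjoint B & C]%fset ->
  inversions A (B `|` C) = (inversions A B + inversions A C)%N.
Proof.
move=> dBC; rewrite /inversions -big_split /=; apply: eq_bigr => a _.
exact: big_fsetU_disj.
Qed.

Lemma gmulA : associative gmul.
Proof.
move=> x y z.
apply: (malg_lin_eq (f1 := fun x => gmul x (gmul y z))
                    (f2 := fun x => gmul (gmul x y) z)).
- by move=> c a b; rewrite gmulPl.
- by move=> c a b; rewrite !gmulPl.
move=> A; rewrite -/(gmon A).
apply: (malg_lin_eq (f1 := fun y => gmul (gmon A) (gmul y z))
                    (f2 := fun y => gmul (gmul (gmon A) y) z)).
- by move=> c a b; rewrite gmulPl gmulPr.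
- by move=> c a b; rewrite gmulPr gmulPl.
move=> B; rewrite -/(gmon B).
apply: (malg_lin_eq (f1 := fun z => gmul (gmon A) (gmul (gmon B) z))
                    (f2 := fun z => gmul (gmul (gmon A) (gmon B)) z)).
- by move=> c a b; rewrite !gmulPr.
- by move=> c a b; rewrite gmulPr.
move=> C; rewrite -/(gmon C) !gmulUU /gmon_mul.
case dBC: [disjoint B & C]%fset; case dAB: [disjoint A & B]%fset;
  rewrite ?gmulZl ?gmulZr ?gmul0l ?gmul0r ?gmulUU /gmon_mul.
- rewrite fdisjointUX fdisjointXU dAB dBC andTb.
  case: [disjoint A & C]%fset; last by rewrite !scaler0.
  rewrite andbT !scalerA -!exprD fsetUA inversionsUl // inversionsUr //.
  by congr (_ ^+ _ *: _); rewrite addnC addnA.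
- by rewrite fdisjointXU dAB andFb scaler0.
- by rewrite fdisjointUX dBC andbF scaler0.
- by [].
Qed.

Lemma gmul1l : left_id gone gmul.
Proof.
move=> x; apply: (malg_lin_eq (f2 := id)) => //; first exact: gmulPr.
move=> A; rewrite -/(gmon A) gmulUU /gmon_mul fdisjoint0X inversions0l.
by rewrite expr0 scale1r fset0U.
Qed.

Lemma gmul1r : right_id gone gmul.
Proof.
move=> x; apply: (malg_lin_eq (f1 := gmul^~ gone) (f2 := id)) => //.
  exact: gmulPl.
move=> A; rewrite -/(gmon A) gmulUU /gmon_mul fdisjointX0 inversions0r.
by rewrite expr0 scale1r fsetU0.
Qed.

Lemma gmulDl : left_distributive gmul +%R.
Proof. by move=> x y z; have := gmulPl z 1 x y; rewrite !scale1r. Qed.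

Lemma gmulDr : right_distributive gmul +%R.
Proof. by move=> x y z; have := gmulPr x 1 y z; rewrite !scale1r. Qed.

Lemma gone_neq0 : gone != 0.
Proof.
apply/eqP => /(congr1 (mcoeff fset0)) /eqP.
by rewrite mcoeff0 mcoeffUU oner_eq0.
Qed.

HB.instance Definition _ := GRing.Zmodule_isNzRing.Build E
  gmulA gmul1l gmul1r gmulDl gmulDr gone_neq0.

Lemma gscaleAl c x y : c *: (x * y) = (c *: x) * y.
Proof. by rewrite -gmulZl. Qed.

Lemma gscaleAr c x y : c *: (x * y) = x * (c *: y).
Proof. by rewrite -gmulZr. Qed.

HB.instance Definition _ := GRing.Lmodule_isLalgebra.Build F E gscaleAl.
HB.instance Definition _ := GRing.Lalgebra_isAlgebra.Build F E gscaleAr.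

Lemma gmonM A B : gmon A * gmon B = gmon_mul A B.
Proof. exact: gmulUU. Qed.

Definition gen (i : nat) : E := gmon [fset i].

Lemma gen_anticomm i j : gen i * gen j = - (gen j * gen i).
Proof.
rewrite !gmonM /gmon_mul !fdisjoint1X !in_fset1 [j == i]eq_sym.
case: ltngtP => [ltij|ltji|_] /=; last by rewrite oppr0.
- rewrite /inversions !big_seq_fset1 ltij ltnNge ltnW //= expr1 expr0.
  by rewrite scaleN1r scale1r opprK fsetUC.
- rewrite /inversions !big_seq_fset1 ltji ltnNge ltnW //= expr1 expr0.
  by rewrite scaleN1r scale1r fsetUC.
Qed.

Lemma gmonE A : gmon A = \prod_(i <- sort leq A) gen i.
Proof.
have prod_gen s : sorted ltn s -> \prod_(i <- s) gen i = gmon [fset i in s].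
  elim: s => [_|i s IHs /= pis].
    by rewrite big_nil; congr gmon; apply/fsetP => i; rewrite !inE.
  have lt_is : all (ltn i) s by apply: order_path_min pis; apply: ltn_trans.
  rewrite big_cons (IHs (path_sorted pis)) gmonM /gmon_mul fdisjoint1X.
  rewrite ifT; last first.
    by rewrite inE; apply/negP => /(allP lt_is) /=; rewrite ltnn.
  rewrite /inversions big_seq_fset1 big_seq big1; last first.
    by move=> b; rewrite inE => /(allP lt_is) /= /ltnW; rewrite ltnNge => ->.
  rewrite expr0 scale1r; congr gmon; apply/fsetP => j; rewrite !inE //.
rewrite prod_gen; first by congr gmon; apply/fsetP => i; rewrite !inE mem_sort.
rewrite ltn_sorted_uniq_leq sort_uniq fset_uniq /=.
by apply: sort_sorted; apply: leq_total.
Qed.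

(* theta_k: e_i |-> e_i for the first k generators, e_j |-> 0 for the others. *)

Definition theta (k : nat) : E -> E :=
  lin_ext (fun A => if all (fun i => i < k)%N A then gmon A else 0).

Lemma theta_is_linear k : linear (theta k). Proof. exact: lin_ext_is_linear. Qed.

HB.instance Definition _ k :=
  GRing.isLinear.Build F E E *:%R (theta k) (theta_is_linear k).

Lemma theta_mon k A :
  theta k (gmon A) = if all (fun i => i < k)%N A then gmon A else 0.
Proof. exact: lin_extU. Qed.

Lemma theta_is_monoid_morphism k : monoid_morphism (theta k).
Proof.
split=> [|x y].
  by rewrite [LHS]theta_mon; case: allP => // -[] i; rewrite in_fset0.
apply: (malg_lin_eq (f1 := fun x : E => theta k (x * y))
                    (f2 := fun x : E => theta k x * theta k y)).
- by move=> c a b; rewrite mulrDl -scalerAl linearP.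
- by move=> c a b; rewrite linearP mulrDl -scalerAl.
move=> A; rewrite -/(gmon A).
apply: (malg_lin_eq (f1 := fun y : E => theta k (gmon A * y))
                    (f2 := fun y : E => theta k (gmon A) * theta k y)).
- by move=> c a b; rewrite mulrDr -scalerAr linearP.
- by move=> c a b; rewrite linearP mulrDr -scalerAr.
move=> B; rewrite -/(gmon B) gmonM !theta_mon /gmon_mul.
have eqU : all (fun i => i < k)%N (A `|` B) =
           all (fun i => i < k)%N A && all (fun i => i < k)%N B.
  rewrite -all_cat; apply: eq_all_r => i; first by rewrite mem_cat in_fsetU.
case: ifP => dAB; rewrite ?linear0 ?linearZ /= ?theta_mon ?eqU;
  do ![case: all => /=]; rewrite ?mulr0 ?mul0r ?scaler0 //.
- by rewrite gmonM /gmon_mul dAB.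
- by rewrite gmonM /gmon_mul dAB.
Qed.

HB.instance Definition _ k :=
  GRing.isMonoidMorphism.Build E E (theta k) (theta_is_monoid_morphism k).

Lemma theta_gen k i : theta k (gen i) = if (i < k)%N then gen i else 0.
Proof.
rewrite theta_mon; congr (if _ then _ else _).
by apply/allP/idP => [|ltik j]; [apply; rewrite inE | rewrite inE => /eqP->].
Qed.

End Grassmann.

(* W-algebras: associative, not necessarily unital, F-algebras A (product     *)
(* wmul) that are unital W-bimodules (actions lact and ract) satisfying the   *)
(* three mixed associativity laws.                                            *)

HB.mixin Record isWAlgebra (F : fieldType) (W : algType F) A
    of GRing.Lmodule F A := {
  wmul : A -> A -> A;
  lact : W -> A -> A;
  ract : A -> W -> A;
  wmulPl : forall b, linear (wmul^~ b);
  wmulPr : forall a, linear (wmul a);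
  wmulA : associative wmul;
  lactPl : forall a, linear (lact^~ a);
  lactPr : forall w, linear (lact w);
  lact1 : forall a, lact 1 a = a;
  lactA : forall v w a, lact (v * w) a = lact v (lact w a);
  ractPl : forall w, linear (ract^~ w);
  ractPr : forall a, linear (ract a);
  ract1 : forall a, ract a 1 = a;
  ractA : forall a v w, ract a (v * w) = ract (ract a v) w;
  lact_ract : forall v a w, ract (lact v a) w = lact v (ract a w);
  wmul_ract : forall a b w, ract (wmul a b) w = wmul a (ract b w);
  lact_wmul : forall w a b, lact w (wmul a b) = wmul (lact w a) b;
  wmul_mid : forall a w b, wmul (ract a w) b = wmul a (lact w b)
}.

#[short(type="wAlgType")]
HB.structure Definition WAlgebra (F : fieldType) (W : algType F) :=
  { A of isWAlgebra F W A & GRing.Lmodule F A }.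

Definition walg_morphism (F : fieldType) (W : algType F) (A B : wAlgType W)
    (f : A -> B) : Prop :=
  [/\ linear f,
      forall a b, f (wmul a b) = wmul (f a) (f b),
      forall w a, f (lact w a) = lact w (f a) &
      forall a w, f (ract a w) = ract (f a) w].

(* B with the actions w a = f(w) a and a w = a f(w).                          *)

Definition along (F : fieldType) (W B : algType F) (f : {lrmorphism W -> B})
  : Type := B.

Section Along.
Variables (F : fieldType) (W B : algType F) (f : {lrmorphism W -> B}).
Implicit Types (a b : B) (v w : W).

HB.instance Definition _ := GRing.Lmodule.on (along f).

Let mulP (a : B) : linear (fun b : B => a * b).
Proof. by move=> c x y; rewrite mulrDr -scalerAr. Qed.
Let mulPl (b : B) : linear (fun a : B => a * b).
Proof. by move=> c x y; rewrite mulrDl -scalerAl. Qed.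
Let lactPl a : linear (fun w => f w * a).
Proof. by move=> c x y; rewrite linearP mulrDl -scalerAl. Qed.
Let ractPr a : linear (fun w => a * f w).
Proof. by move=> c x y; rewrite linearP mulrDr -scalerAr. Qed.
Let lact1 a : f 1 * a = a. Proof. by rewrite rmorph1 mul1r. Qed.
Let ract1 a : a * f 1 = a. Proof. by rewrite rmorph1 mulr1. Qed.
Let lactA v w a : f (v * w) * a = f v * (f w * a).
Proof. by rewrite rmorphM mulrA. Qed.
Let ractA a v w : a * f (v * w) = a * f v * f w.
Proof. by rewrite rmorphM mulrA. Qed.

HB.instance Definition _ := isWAlgebra.Build F W (along f)
  (wmul := fun a b : B => a * b) (lact := fun w (a : B) => f w * a)
  (ract := fun (a : B) w => a * f w)
  mulPl mulP (@mulrA B) lactPl (fun w => mulP (f w)) lact1 lactA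
  (fun w => mulPl (f w)) ractPr ract1 ractA
  (fun v a w => esym (mulrA (f v) a (f w)))
  (fun a b w => esym (mulrA a b (f w)))
  (fun w a b => mulrA (f w) a b)
  (fun a w b => esym (mulrA a (f w) b)).

End Along.

(* The free E-algebra E<X> on x_0, x_1, ...: its basis vector                 *)
(* w_0 x_{j_1} w_1 x_{j_2} ... w_{n-1} x_{j_n} w_n, with n >= 1 and the w_r   *)
(* in the basis of E, is (w_0, (j_1, [:: (w_1, j_2); ...; (w_{n-1}, j_n)]),   *)
(* w_n).                                                                      *)

Definition gword : Type :=
  ({fset nat} * (nat * seq ({fset nat} * nat)) * {fset nat})%type.
HB.instance Definition _ := Choice.on gword.

Definition wfirst (u : gword) : {fset nat} := u.1.1.
Definition wmid (u : gword) : nat * seq ({fset nat} * nat) := u.1.2.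
Definition wlast (u : gword) : {fset nat} := u.2.

Definition glue (u : gword) (C : {fset nat}) (v : gword) : gword :=
  (wfirst u, ((wmid u).1, (wmid u).2 ++ (C, (wmid v).1) :: (wmid v).2),
   wlast v).

Definition free_walg (F : fieldType) : Type := {malg F[gword]}.

Section FreeWAlgebra.
Variable F : fieldType.
Local Notation E := (grassmann F).
Local Notation L := (free_walg F).
Implicit Types (u v : gword) (f g : L) (w : E).

HB.instance Definition _ := GRing.Lmodule.on L.

Definition fword u : L := << u >>.

Definition fword_mul u v : L :=
  lin_ext (fun C => fword (glue u C v)) (gmon F (wlast u) * gmon F (wfirst v)).

Definition fmul : L -> L -> L := bilin_ext fword_mul.

Definition flact w : L -> L :=
  lin_ext (fun u =>
    lin_ext (fun C => fword (C, wmid u, wlast u)) (w * gmon F (wfirst u))).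

Definition fract f w : L :=
  lin_ext (fun u =>
    lin_ext (fun C => fword (wfirst u, wmid u, C)) (gmon F (wlast u) * w)) f.

Lemma fmulPl g : linear (fmul^~ g). Proof. exact: bilin_extPl. Qed.
Lemma fmulPr f : linear (fmul f). Proof. exact: bilin_extPr. Qed.
Lemma flactPr w : linear (flact w). Proof. exact: lin_ext_is_linear. Qed.
Lemma fractPl w : linear (fract^~ w). Proof. exact: lin_ext_is_linear. Qed.

Lemma flactPl f : linear (flact^~ f).
Proof.
move=> c w1 w2; rewrite /flact -lin_ext_fun_linear; apply: eq_lin_ext => u.
by rewrite mulrDl -scalerAl linearP.
Qed.

Lemma fractPr f : linear (fract f).
Proof.
move=> c w1 w2; rewrite /fract -lin_ext_fun_linear; apply: eq_lin_ext => u.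
by rewrite mulrDr -scalerAr linearP.
Qed.

Lemma fmulUU u v : fmul (fword u) (fword v) = fword_mul u v.
Proof. exact: bilin_extU. Qed.

Lemma flactU w u : flact w (fword u) =
  lin_ext (fun C => fword (C, wmid u, wlast u)) (w * gmon F (wfirst u)).
Proof. exact: lin_extU. Qed.

Lemma fractU u w : fract (fword u) w =
  lin_ext (fun C => fword (wfirst u, wmid u, C)) (gmon F (wlast u) * w).
Proof. exact: lin_extU. Qed.

Lemma lin_ext_map (K : choiceType) (V V' : lmodType F) (p : V -> V')
    (h : K -> V) (g : {malg F[K]}) :
  linear p -> p (lin_ext h g) = lin_ext (fun k => p (h k)) g.
Proof.
move=> lin_p.
pose q : {linear _ -> _} :=
  HB.pack p (GRing.isLinear.Build F V V' *:%R p lin_p).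
exact: (lin_ext_comp q).
Qed.

Lemma fmulUX u (h : {fset nat} -> gword) w :
  fmul (fword u) (lin_ext (fun C => fword (h C)) w) =
  lin_ext (fun C => fword_mul u (h C)) w.
Proof.
rewrite (lin_ext_map _ _ (fmulPr _)); apply: eq_lin_ext => C; exact: fmulUU.
Qed.

Lemma fmulXU v (h : {fset nat} -> gword) w :
  fmul (lin_ext (fun C => fword (h C)) w) (fword v) =
  lin_ext (fun C => fword_mul (h C) v) w.
Proof.
rewrite (lin_ext_map _ _ (fmulPl _)); apply: eq_lin_ext => C; exact: fmulUU.
Qed.

Lemma flactX w' (h : {fset nat} -> gword) w :
  flact w' (lin_ext (fun C => fword (h C)) w) =
  lin_ext (fun C => flact w' (fword (h C))) w.
Proof. exact/lin_ext_map/flactPr. Qed.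

Lemma fractX w' (h : {fset nat} -> gword) w :
  fract (lin_ext (fun C => fword (h C)) w) w' =
  lin_ext (fun C => fract (fword (h C)) w') w.
Proof. exact: (lin_ext_map _ _ (fractPl w')). Qed.

Lemma lin_ext_mulr (V : lmodType F) (h : {fset nat} -> V) w w' :
  lin_ext (fun C => lin_ext h (gmon F C * w')) w = lin_ext h (w * w').
Proof.
rewrite -(lin_ext_map (p := fun x : E => lin_ext h (x * w'))).
  by rewrite /lin_ext lin_ext_id.
by move=> c a b; rewrite mulrDl -scalerAl linearP.
Qed.

Lemma lin_ext_mull (V : lmodType F) (h : {fset nat} -> V) w w' :
  lin_ext (fun C => lin_ext h (w' * gmon F C)) w = lin_ext h (w' * w).
Proof.
rewrite -(lin_ext_map (p := fun x : E => lin_ext h (w' * x))).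
  by rewrite /lin_ext lin_ext_id.
by move=> c a b; rewrite mulrDr -scalerAr linearP.
Qed.

Lemma fmulA : associative fmul.
Proof.
move=> f g h.
apply: (malg_lin_eq (f1 := fun f => fmul f (fmul g h))
                    (f2 := fun f => fmul (fmul f g) h)).
- by move=> c a b; rewrite fmulPl.
- by move=> c a b; rewrite !fmulPl.
move=> u; rewrite -/(fword u).
apply: (malg_lin_eq (f1 := fun g => fmul (fword u) (fmul g h))
                    (f2 := fun g => fmul (fmul (fword u) g) h)).
- by move=> c a b; rewrite fmulPl fmulPr.
- by move=> c a b; rewrite fmulPr fmulPl.
move=> v; rewrite -/(fword v).
apply: (malg_lin_eq (f1 := fun h => fmul (fword u) (fmul (fword v) h))
                    (f2 := fun h => fmul (fmul (fword u) (fword v)) h)).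
- by move=> c a b; rewrite !fmulPr.
- by move=> c a b; rewrite fmulPr.
move=> z; rewrite -/(fword z) !fmulUU /fword_mul.
rewrite fmulUX fmulXU /fword_mul.
pose w1 := gmon F (wlast u) * gmon F (wfirst v).
pose w2 := gmon F (wlast v) * gmon F (wfirst z).
rewrite -/w1 -/w2; etransitivity.
  exact: (exchange_lin_ext (fun D C => fword (glue u C (glue v D z))) w2 w1).
apply: eq_lin_ext => C; apply: eq_lin_ext => D.
by rewrite /glue /wmid /= -catA.
Qed.

Lemma flact1 f : flact 1 f = f.
Proof.
apply: (malg_lin_eq (f2 := id)) => //; first exact: flactPr.
move=> u; rewrite -/(fword u) flactU mul1r lin_extU.
by case: u => -[].
Qed.

Lemma fract1 f : fract f 1 = f.
Proof.
apply: (malg_lin_eq (f1 := fract^~ 1) (f2 := id)) => //; first exact: fractPl.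
move=> u; rewrite -/(fword u) fractU mulr1 lin_extU.
by case: u => -[].
Qed.

Lemma flactA w w' f : flact (w * w') f = flact w (flact w' f).
Proof.
apply: (malg_lin_eq (f2 := fun f => flact w (flact w' f))).
- exact: flactPr.
- by move=> c a b; rewrite !flactPr.
move=> u; rewrite -/(fword u) !flactU flactX.
transitivity (lin_ext (fun C =>
  lin_ext (fun D => fword (D, wmid u, wlast u)) (w * gmon F C))
    (w' * gmon F (wfirst u))); first by rewrite lin_ext_mull mulrA.
by apply: eq_lin_ext => C; rewrite flactU.
Qed.

Lemma fractA f w w' : fract f (w * w') = fract (fract f w) w'.
Proof.
apply: (malg_lin_eq (f1 := fract^~ (w * w'))
                    (f2 := fun f => fract (fract f w) w')).
- exact: fractPl.
- by move=> c a b; rewrite !fractPl.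
move=> u; rewrite -/(fword u) !fractU fractX.
transitivity (lin_ext (fun C =>
  lin_ext (fun D => fword (wfirst u, wmid u, D)) (gmon F C * w'))
    (gmon F (wlast u) * w)); first by rewrite lin_ext_mulr mulrA.
by apply: eq_lin_ext => C; rewrite fractU.
Qed.

Lemma flact_fract w f w' : fract (flact w f) w' = flact w (fract f w').
Proof.
apply: (malg_lin_eq (f1 := fun f => fract (flact w f) w')
                    (f2 := fun f => flact w (fract f w'))).
- by move=> c a b; rewrite flactPr fractPl.
- by move=> c a b; rewrite fractPl flactPr.
move=> u; rewrite -/(fword u) [flact w _]flactU [fract (fword u) w']fractU.
rewrite fractX flactX.
pose w1 := w * gmon F (wfirst u); pose w2 := gmon F (wlast u) * w'.
transitivity (lin_ext (fun C => lin_ext (fun D => fword (C, wmid u, D)) w2) w1).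
  by apply: eq_lin_ext => C; rewrite fractU.
rewrite (exchange_lin_ext (fun C D => fword (C, wmid u, D)) w1 w2).
by apply: eq_lin_ext => D; rewrite flactU.
Qed.

Lemma fmul_fract f g w : fract (fmul f g) w = fmul f (fract g w).
Proof.
apply: (malg_lin_eq (f1 := fun f => fract (fmul f g) w)
                    (f2 := fun f => fmul f (fract g w))).
- by move=> c a b; rewrite fmulPl fractPl.
- by move=> c a b; rewrite fmulPl.
move=> u; rewrite -/(fword u).
apply: (malg_lin_eq (f1 := fun g => fract (fmul (fword u) g) w)
                    (f2 := fun g => fmul (fword u) (fract g w))).
- by move=> c a b; rewrite fmulPr fractPl.
- by move=> c a b; rewrite fractPl fmulPr.
move=> v; rewrite -/(fword v) fmulUU [fract (fword v) w]fractU.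
rewrite fmulUX /fword_mul fractX.
pose w1 := gmon F (wlast u) * gmon F (wfirst v).
pose w2 := gmon F (wlast v) * w.
pose h C D := fword (glue u C (wfirst v, wmid v, D)).
transitivity (lin_ext (fun C => lin_ext (h C) w2) w1).
  by apply: eq_lin_ext => C; rewrite fractU.
exact: (exchange_lin_ext h w1 w2).
Qed.

Lemma flact_fmul w f g : flact w (fmul f g) = fmul (flact w f) g.
Proof.
apply: (malg_lin_eq (f1 := fun f => flact w (fmul f g))
                    (f2 := fun f => fmul (flact w f) g)).
- by move=> c a b; rewrite fmulPl flactPr.
- by move=> c a b; rewrite flactPr fmulPl.
move=> u; rewrite -/(fword u).
apply: (malg_lin_eq (f1 := fun g => flact w (fmul (fword u) g))
                    (f2 := fun g => fmul (flact w (fword u)) g)).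
- by move=> c a b; rewrite fmulPr flactPr.
- by move=> c a b; rewrite fmulPr.
move=> v; rewrite -/(fword v) fmulUU [flact w (fword u)]flactU.
rewrite fmulXU /fword_mul flactX.
pose w1 := gmon F (wlast u) * gmon F (wfirst v).
pose w2 := w * gmon F (wfirst u).
pose h C D := fword (glue (D, wmid u, wlast u) C v).
transitivity (lin_ext (fun C => lin_ext (h C) w2) w1).
  by apply: eq_lin_ext => C; rewrite flactU.
exact: (exchange_lin_ext h w1 w2).
Qed.

Lemma fmul_mid f w g : fmul (fract f w) g = fmul f (flact w g).
Proof.
apply: (malg_lin_eq (f1 := fun f => fmul (fract f w) g)
                    (f2 := fun f => fmul f (flact w g))).
- by move=> c a b; rewrite fractPl fmulPl.
- by move=> c a b; rewrite fmulPl.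
move=> u; rewrite -/(fword u).
apply: (malg_lin_eq (f1 := fun g => fmul (fract (fword u) w) g)
                    (f2 := fun g => fmul (fword u) (flact w g))).
- by move=> c a b; rewrite fmulPr.
- by move=> c a b; rewrite flactPr fmulPr.
move=> v; rewrite -/(fword v) [flact w _]flactU [fract _ w]fractU.
rewrite fmulXU fmulUX /fword_mul.
pose h C := fword (glue u C v).
etransitivity; first exact: (lin_ext_mulr h).
by rewrite -mulrA; apply: esym; apply: (lin_ext_mull h).
Qed.

HB.instance Definition _ := isWAlgebra.Build F E L
  fmulPl fmulPr fmulA flactPl flactPr flact1 flactA fractPl fractPr fract1
  fractA flact_fract fmul_fract flact_fmul fmul_mid.

Definition fvar (j : nat) : L := fword (fset0, (j, [::]), fset0).

Section Evaluation.
Variables (A : wAlgType E) (a : nat -> A).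

Definition eval_mid (m : nat * seq ({fset nat} * nat)) : A :=
  foldl (fun b p => wmul (ract b (gmon F p.1)) (a p.2)) (a m.1) m.2.

Definition eval_word u : A :=
  ract (lact (gmon F (wfirst u)) (eval_mid (wmid u))) (gmon F (wlast u)).

Definition weval : L -> A := lin_ext eval_word.

Lemma weval_is_linear : linear weval. Proof. exact: lin_ext_is_linear. Qed.

Lemma weval_fword u : weval (fword u) = eval_word u.
Proof. exact: lin_extU. Qed.

Lemma weval_fvar j : weval (fvar j) = a j.
Proof. by rewrite weval_fword /eval_word /= ract1 lact1. Qed.

Lemma eval_mid_cat j s C l t :
  eval_mid (j, s ++ (C, l) :: t) =
  wmul (ract (eval_mid (j, s)) (gmon F C)) (eval_mid (l, t)).
Proof.
rewrite /eval_mid /= foldl_cat /=; elim/last_ind: t => [//|t p IHt].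
by rewrite !foldl_rcons IHt wmul_ract wmulA.
Qed.

Lemma lin_ext_gmon (p : E -> A) w :
  linear p -> lin_ext (fun C => p (gmon F C)) w = p w.
Proof. by move=> lin_p; rewrite -(lin_ext_map _ _ lin_p) /lin_ext lin_ext_id. Qed.

Lemma weval_morphism : walg_morphism weval.
Proof.
split; first exact: weval_is_linear.
- move=> f g.
  apply: (malg_lin_eq (f1 := fun f : L => weval (wmul f g))
                      (f2 := fun f : L => wmul (weval f) (weval g))).
  + by move=> c x y; rewrite wmulPl weval_is_linear.
  + by move=> c x y; rewrite weval_is_linear wmulPl.
  move=> u; rewrite -/(fword u).
  apply: (malg_lin_eq (f1 := fun g : L => weval (wmul (fword u) g))
                      (f2 := fun g : L => wmul (weval (fword u)) (weval g))).
  + by move=> c x y; rewrite wmulPr weval_is_linear.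
  + by move=> c x y; rewrite weval_is_linear wmulPr.
  move=> v; rewrite -/(fword v) !weval_fword.
  rewrite [wmul (fword u) _]fmulUU /fword_mul (lin_ext_map _ _ weval_is_linear).
  pose p w := ract (lact (gmon F (wfirst u))
    (wmul (ract (eval_mid (wmid u)) w) (eval_mid (wmid v)))) (gmon F (wlast v)).
  transitivity (p (gmon F (wlast u) * gmon F (wfirst v))).
    rewrite -(lin_ext_gmon (p := p)); last first.
      by move=> c x y; rewrite /p ractPr wmulPl lactPr ractPl.
    apply: eq_lin_ext => C; rewrite weval_fword /eval_word /p; congr (ract (lact _ _) _).
    by rewrite eval_mid_cat -!surjective_pairing.
  by rewrite /p /eval_word ractA wmul_mid -wmul_ract lact_wmul lact_ract.
- move=> w f.
  apply: (malg_lin_eq (f1 := fun f : L => weval (lact w f))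
                      (f2 := fun f : L => lact w (weval f))).
  + by move=> c x y; rewrite lactPr weval_is_linear.
  + by move=> c x y; rewrite weval_is_linear lactPr.
  move=> u; rewrite -/(fword u) weval_fword [lact w (fword u)]flactU.
  rewrite (lin_ext_map _ _ weval_is_linear).
  pose p w := ract (lact w (eval_mid (wmid u))) (gmon F (wlast u)).
  transitivity (p (w * gmon F (wfirst u))); last first.
    by rewrite /p lactA -lact_ract.
  rewrite -(lin_ext_gmon (p := p)); first by apply: eq_lin_ext => C; rewrite weval_fword.
  by move=> c x y; rewrite /p lactPl ractPl.
- move=> f w.
  apply: (malg_lin_eq (f1 := fun f : L => weval (ract f w))
                      (f2 := fun f : L => ract (weval f) w)).
  + by move=> c x y; rewrite ractPl weval_is_linear.
  + by move=> c x y; rewrite weval_is_linear ractPl.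
  move=> u; rewrite -/(fword u) weval_fword [ract (fword u) w]fractU.
  rewrite (lin_ext_map _ _ weval_is_linear).
  pose p w := ract (lact (gmon F (wfirst u)) (eval_mid (wmid u))) w.
  transitivity (p (gmon F (wlast u) * w)); last by rewrite /p ractA.
  rewrite -(lin_ext_gmon (p := p)); first by apply: eq_lin_ext => C; rewrite weval_fword.
  by move=> c x y; rewrite /p ractPr.
Qed.

End Evaluation.

Lemma eval_mid_fvar m : eval_mid fvar m = fword (fset0, m, fset0).
Proof.
case: m => j s; elim/last_ind: s => [//|s [C l] IHs].
rewrite -cats1 eval_mid_cat IHs.
rewrite [ract _ _]fractU /wlast /wfirst /= -/(gone F) mul1r lin_extU.
by rewrite [LHS]fmulUU /fword_mul /= mulr1 lin_extU.
Qed.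

Lemma eval_word_fvar u : eval_word fvar u = fword u.
Proof.
rewrite /eval_word eval_mid_fvar [lact _ _]flactU mulr1 lin_extU.
by rewrite [LHS]fractU mul1r lin_extU; case: u => -[].
Qed.

Lemma walg_morphism_eval (A : wAlgType E) (phi : L -> A) :
  walg_morphism phi -> phi =1 weval (fun j => phi (fvar j)).
Proof.
case=> lin_phi phiM phil phir; apply: malg_lin_eq => //.
  exact: weval_is_linear.
move=> u; rewrite -/(fword u) weval_fword -[in LHS]eval_word_fvar /eval_word.
rewrite phir phil; congr (ract (lact _ _) _).
case: (wmid u) => j s; elim/last_ind: s => [//|s [C l] IHs].
by rewrite -!cats1 !eval_mid_cat phiM phir IHs.
Qed.

End FreeWAlgebra.

Section TIdeals.
Variables (F : fieldType) (W : algType F) (L : wAlgType W).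
Implicit Types I J : L -> Prop.

Definition T_ideal I : Prop :=
  [/\ I 0 /\ (forall c f g, I f -> I g -> I (c *: f + g)),
      (forall f g, I f -> I (wmul f g)) /\ (forall f g, I g -> I (wmul f g)),
      (forall w f, I f -> I (lact w f)) /\ (forall f w, I f -> I (ract f w)) &
      forall phi : L -> L, walg_morphism phi -> forall f, I f -> I (phi f)].

Definition fin_gen_T_ideal I : Prop :=
  exists S : seq L,
    [/\ T_ideal I, forall f, f \in S -> I f &
        forall J, T_ideal J -> (forall f, f \in S -> J f) ->
          forall f, I f -> J f].

End TIdeals.

Definition gpi (F : fieldType) (A : wAlgType (grassmann F)) (f : free_walg F) :
  Prop := forall a : nat -> A, weval a f = 0.

Lemma gpi_T_ideal (F : fieldType) (A : wAlgType (grassmann F)) :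
  T_ideal (@gpi F A).
Proof.
have ev a := weval_morphism (A := A) a.
split.
- split=> [a|c f g If Ig a]; case: (ev a) => lin _ _ _.
    by have := lin (-1) 0 0; rewrite !scaleN1r !addNr.
  by rewrite lin If Ig scaler0 addr0.
- split=> f g I0 a; case: (ev a) => _ evM _ _; rewrite evM I0.
    by have := wmulPl (weval a g) (-1) 0 0; rewrite !scaleN1r !addNr.
  by have := wmulPr (weval a f) (-1) 0 0; rewrite !scaleN1r !addNr.
- split=> [w f|f w] I0 a; case: (ev a) => _ _ evl evr; rewrite ?evl ?evr I0.
    by have := lactPr (s := A) w (-1) 0 0; rewrite !scaleN1r !addNr.
  by have := ractPl (s := A) w (-1) 0 0; rewrite !scaleN1r !addNr.
move=> phi [phi_lin phiM phil phir] f If a.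
have [lin evM evl evr] := ev a.
have mor : walg_morphism (weval a \o phi).
  split=> [c x y|x y|w x|x w] /=.
  - by rewrite phi_lin lin.
  - by rewrite phiM evM.
  - by rewrite phil evl.
  - by rewrite phir evr.
by rewrite [LHS](walg_morphism_eval mor) If.
Qed.

Definition grassmann_trunc (F : fieldType) (k : nat) :
  wAlgType (grassmann F) := along (@theta F k).

Definition grassmann_self (F : fieldType) :
  wAlgType (grassmann F) := along (@idfun (grassmann F)).

(* Main.v *)
Require Import Defs.
From HB Require Import structures.
From mathcomp Require Import all_boot all_algebra finmap.
From mathcomp.multinomials Require Import monalg.

(** A T-ideal generated by a finite set S involves only finitely many
    generators of the Grassmann algebra E, so to refute finite generation it
    suffices to exhibit, for a generator e_i that is absent from S, an
    E-algebra in which S vanishes identically but some generalized identity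
    involving e_i does not. The identity is e_i x e_i, which holds on E because
    e_i commutes or anticommutes with every monomial (and holds on E^(k) because
    e_i acts there as itself or as 0).

    The E-algebra is a bimodule with zero product. Reading off the constant
    term and the e_i-coefficient of w gives a morphism from E to the dual
    numbers F[n]/(n^2), realised here by upper triangular 2 x 2 matrices with n
    the matrix unit E_01 (the map [jet i]). Let E act through it on all 2 x 2
    matrices, on both sides. Then e_i x e_i acts as n x n, which is nonzero for
    x = E_10, whereas the products of variables and the generators other than
    e_i act as 0. Thus the value of an f not involving e_i depends only on the
    coefficients of the bare variables x_j in f.

    Those coefficients vanish for every generalized identity f of E
    ([gpi_coef_var]): substitute e_0 for x_j and 0 for the other variables; the
    words with a second factor, be it a variable or a nontrivial monomial of E,
    have no component on e_0, so the coefficient of x_j is the e_0-component of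
    the value of f. The same holds for E^(k), where e_i still acts as an element
    without constant term. *)

Set Implicit Arguments.
Unset Strict Implicit.
Unset Printing Implicit Defensive.

Import GRing.Theory.
Local Open Scope fset_scope.
Local Open Scope ring_scope.

(** * Constant and linear coefficients in the Grassmann algebra *)

Section GrassmannCoefficients.
Variable F : fieldType.
Local Notation E := (grassmann F).
Implicit Types (x y : E) (A B : {fset nat}) (i : nat).

Lemma grassmann_bilin_eq (V : lmodType F) (f1 f2 : E -> E -> V) :
  (forall y, linear (f1^~ y)) -> (forall x, linear (f1 x)) ->
  (forall y, linear (f2^~ y)) -> (forall x, linear (f2 x)) ->
  (forall A B, f1 (gmon F A) (gmon F B) = f2 (gmon F A) (gmon F B)) ->
  forall x y, f1 x y = f2 x y.
Proof.
move=> l1 r1 l2 r2 eqf x y.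
apply: (malg_lin_eq (f1 := f1^~ y) (f2 := f2^~ y)) => // A.
by apply: (malg_lin_eq (r1 _) (r2 _)) => B; apply: eqf.
Qed.

Lemma coef_linear A c x y : (c *: x + y)@_A = c * x@_A + y@_A.
Proof. by rewrite mcoeffD mcoeffZ. Qed.

Lemma coef_gmon A B : (gmon F A)@_B = (A == B)%:R.
Proof. exact: mcoeffU. Qed.

Lemma coef_gmonM A B C :
  (gmon F A * gmon F B)@_C
  = [disjoint A & B]%fset%:R * (-1) ^+ inversions A B * (A `|` B == C)%:R.
Proof.
rewrite gmonM /gmon_mul; case: ifP => _; last by rewrite mcoeff0 !mul0r.
by rewrite mcoeffZ coef_gmon mul1r.
Qed.

Lemma coef0M x y : (x * y)@_fset0 = x@_fset0 * y@_fset0.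
Proof.
apply: (grassmann_bilin_eq (V := F^o) (f1 := fun x y => (x * y)@_fset0)
                           (f2 := fun x y => x@_fset0 * y@_fset0)) => {x y}.
- by move=> y c a b; rewrite mulrDl -scalerAl coef_linear.
- by move=> x c a b; rewrite mulrDr -scalerAr coef_linear.
- by move=> y c a b; rewrite coef_linear mulrDl -mulrA.
- by move=> x c a b; rewrite coef_linear mulrDr mulrCA.
move=> A B; rewrite coef_gmonM !coef_gmon fsetU_eq0.
have [->|_] := eqVneq A fset0; last by rewrite mul0r mulr0.
by rewrite fdisjoint0X inversions0l !mul1r.
Qed.

(** Linear coefficients obey the Leibniz rule, the sign rule being invisible in
    degree at most 1. *)
Lemma coef1M i x y :
  (x * y)@_[fset i] = x@_fset0 * y@_[fset i] + x@_[fset i] * y@_fset0.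
Proof.
apply: (grassmann_bilin_eq (V := F^o) (f1 := fun x y => (x * y)@_[fset i])
  (f2 := fun x y => x@_fset0 * y@_[fset i] + x@_[fset i] * y@_fset0)) => {x y}.
- by move=> y c a b; rewrite mulrDl -scalerAl coef_linear.
- by move=> x c a b; rewrite mulrDr -scalerAr coef_linear.
- move=> y c a b; rewrite !coef_linear !mulrDl -!mulrA addrACA.
  by rewrite scalerDr.
- move=> x c a b; rewrite !coef_linear !mulrDr ![_ * (c * _)]mulrCA addrACA.
  by rewrite scalerDr.
have neq i0 : (fset0 == [fset i0 : nat]) = false.
  by rewrite eq_sym -cardfs_eq0 cardfs1.
move=> A B; rewrite coef_gmonM !coef_gmon.
have [->|A0] := eqVneq A fset0.
  by rewrite fdisjoint0X inversions0l fset0U neq !mul1r mul0r addr0.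
have [->|B0] := eqVneq B fset0.
  by rewrite fdisjointX0 inversions0r fsetU0 neq !mul1r mulr1 mulr0 add0r.
rewrite mul0r mulr0 addr0.
have [dAB|] := boolP [disjoint A & B]%fset; last by rewrite !mul0r.
case: eqP => [eqU|_]; last by rewrite mulr0.
(* Nonempty sets whose union is a singleton are both equal to it. *)
have subs C : C != fset0 -> C `<=` [fset i] -> C = [fset i].
  by move=> C0; rewrite fsubset1 (negPf C0) orbF => /eqP.
have eA : A = [fset i] by apply: subs; rewrite // -eqU fsubsetUl.
have eB : B = [fset i] by apply: subs; rewrite // -eqU fsubsetUr.
by move: dAB; rewrite eA eB fdisjoint1X !inE eqxx.
Qed.

(** The anticommutation rule makes e_i y e_i a multiple of y e_i e_i = 0 for
    each monomial y. *)
Lemma gen_sandwich i y : gen F i * y * gen F i = 0.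
Proof.
apply: (malg_lin_eq (f1 := fun y : E => gen F i * y * gen F i)
                    (f2 := fun=> 0 : E)).
- by move=> c a b; rewrite mulrDr mulrDl -scalerAr -scalerAl.
- by move=> c a b; rewrite scaler0 addr0.
move=> A; rewrite -/(gmon F A) gmonM /gmon_mul.
case: ifP => _; last by rewrite mul0r.
by rewrite -scalerAl gmonM /gmon_mul fdisjointX1 !inE eqxx scaler0.
Qed.

(** The 1-jet of x in the variable e_i, as a dual number. *)
Definition jet i (x : E) : 'M[F]_2 :=
  (x@_fset0)%:A + x@_[fset i] *: delta_mx 0 1.

Lemma jet_is_linear i : linear (jet i).
Proof.
move=> c x y; rewrite /jet !coef_linear !scalerDl -!scalerA.
by rewrite addrACA -scalerDr.
Qed.

Lemma jet_is_monoid_morphism i : monoid_morphism (jet i).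
Proof.
split.
  rewrite /jet !coef_gmon eqxx scale1r.
  by rewrite eq_sym -cardfs_eq0 cardfs1 scale0r addr0.
move=> x y; rewrite /jet coef0M coef1M !mulrDl !mulrDr.
rewrite -!scalerAl -!scalerAr !mul1r mulr1 -mulmxE mul_delta_mx_0 //.
rewrite !scaler0 addr0.
by rewrite !scalerA -addrA -scalerDl mulrC.
Qed.

HB.instance Definition _ i :=
  GRing.isLinear.Build F E 'M[F]_2 *:%R (jet i) (jet_is_linear i).
HB.instance Definition _ i :=
  GRing.isMonoidMorphism.Build E 'M[F]_2 (jet i) (jet_is_monoid_morphism i).

Lemma jet_gen i : jet i (gen F i) = delta_mx 0 1.
Proof.
by rewrite /jet !coef_gmon -cardfs_eq0 cardfs1 eqxx scale0r scale1r add0r.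
Qed.

Lemma jet_gmon_notin i A : i \notin A -> jet i (gmon F A) = (A == fset0)%:R.
Proof.
move=> iA; rewrite /jet !coef_gmon; have [eA|_] := eqVneq A [fset i].
  by rewrite eA !inE eqxx in iA.
by rewrite scale0r addr0; case: eqP; rewrite (scale1r, scale0r).
Qed.

End GrassmannCoefficients.

(** * Bimodules with zero product *)

(** B with W acting on both sides through f, as in [along f], but with zero
    product. *)
Definition null_along (F : fieldType) (W B : algType F)
  (f : {lrmorphism W -> B}) : Type := B.

Section NullAlong.
Variables (F : fieldType) (W B : algType F) (f : {lrmorphism W -> B}).

HB.instance Definition _ := GRing.Lmodule.on (null_along f).

Let zeroP : linear (fun _ : B => 0 : B).
Proof. by move=> c x y; rewrite scaler0 addr0. Qed.
Let mulP (a : B) : linear (fun b : B => a * b).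
Proof. by move=> c x y; rewrite mulrDr -scalerAr. Qed.
Let mulPl (b : B) : linear (fun a : B => a * b).
Proof. by move=> c x y; rewrite mulrDl -scalerAl. Qed.
Let lactPl a : linear (fun w => f w * a).
Proof. by move=> c x y; rewrite linearP mulrDl -scalerAl. Qed.
Let ractPr a : linear (fun w => a * f w).
Proof. by move=> c x y; rewrite linearP mulrDr -scalerAr. Qed.
Let lact1 a : f 1 * a = a. Proof. by rewrite rmorph1 mul1r. Qed.
Let ract1 a : a * f 1 = a. Proof. by rewrite rmorph1 mulr1. Qed.
Let lactA v w a : f (v * w) * a = f v * (f w * a).
Proof. by rewrite rmorphM mulrA. Qed.
Let ractA a v w : a * f (v * w) = a * f v * f w.
Proof. by rewrite rmorphM mulrA. Qed.

HB.instance Definition _ := isWAlgebra.Build F W (null_along f)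
  (wmul := fun _ _ : B => 0 : B) (lact := fun w (a : B) => f w * a)
  (ract := fun (a : B) w => a * f w)
  (fun=> zeroP) (fun=> zeroP) (fun _ _ _ => erefl) lactPl (fun w => mulP (f w))
  lact1 lactA (fun w => mulPl (f w)) ractPr ract1 ractA
  (fun v a w => esym (mulrA (f v) a (f w)))
  (fun _ _ w => mul0r (f w)) (fun w _ _ => mulr0 (f w)) (fun _ _ _ => erefl).

Lemma null_along_actE w (a : null_along f) w' :
  ract (lact w a) w' = f w * (a : B) * f w'.
Proof. by []. Qed.

End NullAlong.

(** * Identities that no finite set generates *)

Section NotFinitelyGenerated.
Variable F : fieldType.
Local Notation E := (grassmann F).
Local Notation L := (free_walg F).

Section Coefficients.
Variable g : {lrmorphism E -> E}.
Hypothesis g_sandwich : forall i y, g (gen F i) * y * g (gen F i) = 0.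

(** Each g(e_i) squares to zero, hence has no constant term, so g preserves
    constant terms. *)
Lemma coef0_gmon A : (g (gmon F A))@_fset0 = (A == fset0)%:R.
Proof.
have coef0_gen i : (g (gen F i))@_fset0 = 0.
  have /(congr1 (mcoeff fset0)) := g_sandwich i 1.
  by rewrite mulr1 coef0M mcoeff0 => /eqP; rewrite mulf_eq0 orbb => /eqP.
have [->|] := eqVneq A fset0.
  by rewrite -/(gone F) (rmorph1 g) coef_gmon eqxx.
rewrite -cardfs_eq0 -(size_sort leq) gmonE.
case: (sort leq A) => [//|i s] _.
by rewrite big_cons (rmorphM g) coef0M coef0_gen mul0r.
Qed.

Variable j : nat.
Let a i : along g := if i == j then gen F 0 else 0.

Let coef0_a i : (a i : E)@_fset0 = 0.
Proof.
rewrite /a; case: eqP => _; last exact: mcoeff0.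
by rewrite coef_gmon -cardfs_eq0 cardfs1.
Qed.

Let coef0_eval_mid m : (eval_mid a m : E)@_fset0 = 0.
Proof.
case: m => i s; elim/last_ind: s => [|s [C l] _]; first exact: coef0_a.
by rewrite -cats1 eval_mid_cat [LHS]coef0M [X in _ * X]coef0_a mulr0.
Qed.

Let coef1_eval_mid m : (eval_mid a m : E)@_[fset 0%N] = (m == (j, [::]))%:R.
Proof.
case: m => i s; elim/last_ind: s => [|s [C l] _].
  rewrite xpair_eqE andbT /eval_mid /= /a.
  case: eqP => _; last exact: mcoeff0.
  by rewrite coef_gmon eqxx.
rewrite -cats1 eval_mid_cat [LHS]coef1M [X in _ + _ * X]coef0_a mulr0 addr0.
rewrite [X in X * _]coef0M coef0_eval_mid !mul0r.
by rewrite xpair_eqE -size_eq0 size_cat addn1 andbF.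
Qed.

(** The evaluation x_j := e_0, x_l := 0 for l != j isolates the coefficient of
    x_j: any further variable or nontrivial entry of a word brings a factor
    with no constant term, which leaves nothing on e_0. *)
Lemma gpi_coef_var (f : L) :
  gpi (along g) f -> f@_(fset0, (j, [::]), fset0) = 0.
Proof.
move=> /(_ a) /(congr1 (mcoeff [fset 0%N])); rewrite mcoeff0 => <-.
(* The e_0-component of the value and the coefficient of x_j are both linear
   in f, so it is enough to compare them on words. *)
apply: (malg_lin_eq (V := F^o)
  (f1 := fun f : L => f@_(fset0, (j, [::]), fset0))
  (f2 := fun f : L => (weval a f : E)@_[fset 0%N])).
- by move=> c x y; rewrite mcoeffD mcoeffZ.
- by move=> c x y; rewrite weval_is_linear coef_linear.
case=> -[I m] J; rewrite -/(fword F (I, m, J)) weval_fword mcoeffU.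
rewrite !xpair_eqE /eval_word [RHS]coef1M [X in X * _]coef0M.
rewrite coef0_eval_mid mulr0 mul0r add0r [X in X * _]coef1M coef0_eval_mid.
rewrite coef1_eval_mid !coef0_gmon mulr0 addr0.
by case: (I == _); case: (J == _); case: (m == _);
  rewrite ?(mul0r, mul1r, mulr0).
Qed.

End Coefficients.

(** Only the outer entries of the words matter in an algebra with zero product,
    where the words with inner entries vanish anyway. *)
Definition outer_letters (f : L) : seq nat :=
  flatten [seq enum_fset (wfirst u) ++ enum_fset (wlast u) | u <- msupp f].

(** With zero product a word survives only if it has a single variable, and
    without e_i its outer entries then act as their constant terms. *)
Lemma gpi_null_jet i (f : L) :
  (forall j, f@_(fset0, (j, [::]), fset0) = 0) ->
  i \notin outer_letters f -> gpi (null_along (@jet F i)) f.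
Proof.
move=> f0 iNf a; rewrite /weval /lin_ext big_seq big1 // => -[[I [j s]] J] uf.
rewrite /eval_word /=; case: (lastP s) => [|t [C l]] in uf *; last first.
  rewrite -cats1 eval_mid_cat.
  by rewrite [lact _ _]mulr0 [ract _ _]mul0r scaler0.
have /norP[iI iJ] : ~~ ((i \in I) || (i \in J)).
  apply: contra iNf => iIJ; apply/flattenP.
  exists (enum_fset I ++ enum_fset J); last by rewrite mem_cat.
  by apply/mapP; exists (I, (j, [::]), J).
rewrite null_along_actE /= !jet_gmon_notin //.
have [I0|_] := eqVneq I fset0; last by rewrite !mul0r scaler0.
have [J0|_] := eqVneq J fset0; last by rewrite mulr0 scaler0.
by rewrite I0 J0 f0 scale0r.
Qed.

(** The hypothesis says that each e_i x e_i is an identity of E acted on through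
    g, which holds both for the identity map and for the truncations. *)
Theorem gpi_along_not_fin_gen (g : {lrmorphism E -> E}) :
  (forall i y, g (gen F i) * y * g (gen F i) = 0) ->
  ~ fin_gen_T_ideal (@gpi F (along g)).
Proof.
move=> g_sandwich [S [_ Sg minS]].
pose letters := flatten (map outer_letters S).
pose i := (\max_(l <- letters) l).+1.
have iN f : f \in S -> i \notin outer_letters f.
  move=> fS; apply/negP => ifS.
  have /(@leq_bigmax_seq _ letters xpredT id) : i \in letters.
    by apply/flattenP; exists (outer_letters f); rewrite ?map_f.
  by move=> /(_ isT); rewrite ltnn.
pose f : L := fword F ([fset i], (0%N, [::]), [fset i]).
have gf : gpi (along g) f.
  by move=> a; rewrite weval_fword /eval_word; apply: g_sandwich.
have Jf : gpi (null_along (@jet F i)) f.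
  apply: minS gf; first exact: gpi_T_ideal.
  move=> h hS; apply: gpi_null_jet (iN _ hS) => j.
  exact: gpi_coef_var (Sg _ hS).
have := Jf (fun=> delta_mx 1 0); rewrite weval_fword /eval_word /=.
rewrite null_along_actE /wfirst /= -/(gen F i) jet_gen -!mulmxE.
by rewrite !mul_delta_mx => /matrixP /(_ 0 1) /eqP; rewrite !mxE !eqxx oner_eq0.
Qed.

End NotFinitelyGenerated.

Theorem corollary8p6 (F : fieldType) (charF : [pchar F] =i pred0) :
  (forall k : nat, (1 <= k)%N ->
     ~ fin_gen_T_ideal (@gpi F (grassmann_trunc F k))) /\
  ~ fin_gen_T_ideal (@gpi F (grassmann_self F)).
Proof.
split=> [k _|]; last exact/gpi_along_not_fin_gen/gen_sandwich.
have theta_sandwich i y : theta k (gen F i) * y * theta k (gen F i) = 0.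
  rewrite theta_gen; case: ifP => _; first exact: gen_sandwich.
  by rewrite !mul0r.
exact: (gpi_along_not_fin_gen (g := @theta F k) theta_sandwich).
Qed.
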